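(* Let $\tau:S\to(\mathcal{D} S)^{\mathcal{A}}$ be an LMP and let $d$ be a $1$-bounded pseudometric on $S$. If $d$ is a fixpoint of $\Delta_{LP}$ (i.e. $\Delta_{LP}(d)=d$), then for every $\epsilon>0$ the relation $R_\epsilon=\{(s,t)\in S\times S\mid d(s,t)<\epsilon\}$ is an $\epsilon$-bisimulation.
   Context: $\mathcal{D} S=\{\varphi:S\to[0,1]\mid \sum_{s\in S}\varphi(s)\le 1\}$ is the set of discrete subdistributions on $S$; for $X\subseteq S$, $\varphi(X)=\sum_{x\in X}\varphi(x)$. An LMP over a set of actions $\mathcal{A}$ is a map $\tau:S\to(\mathcal{D} S)^{\mathcal{A}}$; write $\tau_a(s)=\tau(s)(a)$. For $\epsilon\in[0,1]$, a relation $R\subseteq S\times S$ is an $\epsilon$-simulation if whenever $sRt$, for all $a\in\mathcal{A}$ and all $X\subseteq S$, $\tau_a(s)(X)\le\tau_a(t)(R(X))+\epsilon$, where $R(X)=\{y\mid\exists x\in X: xRy\}$; a symmetric $\epsilon$-simulation is an $\epsilon$-bisimulation. For a $1$-bounded pseudometric $d$ on $S$ (values in $[0,1]$), $X\subseteq S$ and $\epsilon\ge0$, $X^d_\epsilon=\{y\mid\exists x\in X: d(x,y)<\epsilon\}$; $\delta^d_{LP}(\mu_0,\mu_1)=\inf\{\epsilon\ge0\mid\forall X\subseteq S:\ \mu_i(X)\le\mu_{1-i}(X^d_\epsilon)+\epsilon,\ i=0,1\}$; and $\Delta_{LP}(d)(s_0,s_1)=\sup_{a\in\mathcal{A}}\delta^d_{LP}(\tau_a(s_0),\tau_a(s_1))$.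 *)

(* Defs.v *)
From HB Require Import structures.
From mathcomp Require Import all_boot all_order all_algebra.
From mathcomp Require Import all_classical all_reals ereal esum.

Set Implicit Arguments.
Unset Strict Implicit.
Unset Printing Implicit Defensive.

Import Order.TTheory GRing.Theory Num.Theory.
Local Open Scope classical_set_scope.
Local Open Scope ring_scope.

(* [S] is an arbitrary, possibly uncountable, set of states: sums over its
   subsets are the unordered sums [\esum] of nonnegative terms. *)
Record subdistr (R : realType) (S : choiceType) := Subdistr {
  mass :> S -> R ;
  mass_itv : forall s, 0 <= mass s <= 1 ;
  mass_sum : (\esum_(s in [set: S]) (mass s)%:E <= 1)%E
}.

Definition measure_of (R : realType) (S : choiceType)
    (phi : subdistr R S) (X : set S) : \bar R :=
  (\esum_(x in X) (phi x)%:E)%E.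

(* [tau s a] is the subdistribution written tau_a(s). *)
Definition lmp (R : realType) (S : choiceType) (A : Type) :=
  S -> A -> subdistr R S.

Definition rel_image (S : Type) (r : set (S * S)) (X : set S) : set S :=
  [set y | exists2 x, X x & r (x, y)].

Definition eps_simulation (R : realType) (S : choiceType) (A : Type)
    (tau : lmp R S A) (eps : R) (r : set (S * S)) : Prop :=
  forall s t, r (s, t) -> forall (a : A) (X : set S),
    (measure_of (tau s a) X <= measure_of (tau t a) (rel_image r X) + eps%:E)%E.

Definition eps_bisimulation (R : realType) (S : choiceType) (A : Type)
    (tau : lmp R S A) (eps : R) (r : set (S * S)) : Prop :=
  (forall s t, r (s, t) -> r (t, s)) /\ eps_simulation tau eps r.

Definition pseudometric1 (R : realType) (S : Type) (d : S -> S -> R) : Prop :=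
  [/\ forall x y, 0 <= d x y <= 1,
      forall x, d x x = 0,
      forall x y, d x y = d y x &
      forall x y z, d x z <= d x y + d y z].

Definition fattening (R : realType) (S : Type) (d : S -> S -> R)
    (eps : R) (X : set S) : set S :=
  [set y | exists2 x, X x & d x y < eps].

Definition LP_dist (R : realType) (S : choiceType) (d : S -> S -> R)
    (mu0 mu1 : subdistr R S) : R :=
  inf [set eps : R | 0 <= eps /\ forall X : set S,
    (measure_of mu0 X <= measure_of mu1 (fattening d eps X) + eps%:E)%E /\
    (measure_of mu1 X <= measure_of mu0 (fattening d eps X) + eps%:E)%E].

(* The supremum is taken in [0, 1]: for an empty [A] it is [sup set0 = 0]. *)
Definition Delta_LP (R : realType) (S : choiceType) (A : Type)
    (tau : lmp R S A) (d : S -> S -> R) : S -> S -> R :=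
  fun s0 s1 => sup (range (fun a : A => LP_dist d (tau s0 a) (tau s1 a))).

(* Main.v *)
Require Import Defs.
From mathcomp Require Import all_boot all_order all_algebra.
From mathcomp Require Import all_classical all_reals ereal esum.
Import Order.TTheory GRing.Theory Num.Theory.
Local Open Scope classical_set_scope.
Local Open Scope ring_scope.

(** The image of [X] under the relation [d s t < eps] is exactly the [eps]-fattening of [X]. If
    [d s t < eps], the fixpoint equation bounds each [LP_dist d (tau s a) (tau t a)] by [d s t]
    ([LP_dist_le_Delta]), hence strictly below [eps]; then [LP_dist_lt] yields the simulation
    inequality. Symmetry comes from that of [d]. *)

Lemma measure_of_ge0 (R : realType) (S : choiceType) (mu : subdistr R S)
    (X : set S) : (0 <= measure_of mu X)%E.
Proof.
by apply: esum_ge0 => x _; rewrite lee_fin; case/andP: (mass_itv mu x).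
Qed.

Lemma le_measure_of (R : realType) (S : choiceType) (mu : subdistr R S)
    (X Y : set S) : X `<=` Y -> (measure_of mu X <= measure_of mu Y)%E.
Proof.
move=> XY; rewrite /measure_of.
rewrite [leRHS](esumID X) => [|x _].
  rewrite setIidr // leeDl // esum_ge0 // => x _.
  by rewrite lee_fin; case/andP: (mass_itv mu x).
by rewrite lee_fin; case/andP: (mass_itv mu x).
Qed.

Lemma measure_of_le1 (R : realType) (S : choiceType) (mu : subdistr R S)
    (X : set S) : (measure_of mu X <= 1)%E.
Proof. exact: le_trans (le_measure_of _ _ _ _ _ (@subsetT _ X)) (mass_sum mu). Qed.

Section LP.
Context {R : realType} {S : choiceType} (d : S -> S -> R).
Implicit Types mu : subdistr R S.

Let LP_set mu0 mu1 := [set eps : R | 0 <= eps /\ forall X : set S,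
  (measure_of mu0 X <= measure_of mu1 (fattening d eps X) + eps%:E)%E /\
  (measure_of mu1 X <= measure_of mu0 (fattening d eps X) + eps%:E)%E].

(** A slack of 1 absorbs any total mass. This makes the set of admissible radii nonempty, so that
    its [inf] is a genuine infimum. *)
Let LP_set1 mu0 mu1 : LP_set mu0 mu1 1.
Proof.
split=> // X; split; rewrite (le_trans (measure_of_le1 _ _ _ X)) //;
  by rewrite leeDr // measure_of_ge0.
Qed.

Let LP_set_lb mu0 mu1 : has_lbound (LP_set mu0 mu1).
Proof. by exists 0 => e []. Qed.

Lemma LP_dist_le1 mu0 mu1 : LP_dist d mu0 mu1 <= 1.
Proof. exact: ge_inf (LP_set_lb mu0 mu1) _ (LP_set1 mu0 mu1). Qed.

(* An infimum below [eps] is witnessed by some admissible [e < eps], and both the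
   fattening and the additive slack grow with the radius, so [LP_dist < eps]
   makes [eps] itself admissible. *)
Lemma LP_dist_lt mu0 mu1 (eps : R) (X : set S) : LP_dist d mu0 mu1 < eps ->
  (measure_of mu0 X <= measure_of mu1 (fattening d eps X) + eps%:E)%E.
Proof.
move=> /(inf_lt (ex_intro _ 1 (LP_set1 mu0 mu1)))[e [_ /(_ X)[le_e _]] lt_e].
apply: le_trans le_e _; apply: leeD; last by rewrite lee_fin ltW.
by apply: le_measure_of => y [x Xx dxy]; exists x => //; apply: lt_trans lt_e.
Qed.

(** A real [sup] dominates its set only when that set is bounded above; here [LP_dist_le1] gives the
    bound 1, uniformly in the action. *)
Lemma LP_dist_le_Delta (A : Type) (tau : lmp R S A) (s t : S) (a : A) :
  LP_dist d (tau s a) (tau t a) <= Delta_LP tau d s t.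
Proof.
apply: ub_le_sup; last by exists a.
by exists 1 => _ [b _ <-]; apply: LP_dist_le1.
Qed.

End LP.

Theorem theorem11 (R : realType) (S : choiceType) (A : Type)
    (tau : lmp R S A) (d : S -> S -> R) (hd : pseudometric1 d)
    (hfix : Delta_LP tau d = d) :
  forall eps : R, 0 < eps ->
    eps_bisimulation tau eps [set st : S * S | d st.1 st.2 < eps].
Proof.
move=> eps _; have [_ _ dC _] := hd.
split=> [s t /=|s t /= dst a X]; first by rewrite dC.
(* [rel_image] of the relation unfolds to [fattening d eps X], so the lemma applies by
   conversion. *)
apply: (LP_dist_lt d); apply: le_lt_trans dst.
by rewrite -[in leRHS]hfix LP_dist_le_Delta.
Qed.
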